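(* Let $q$ be a prime power and let $P$ be a base point of the Pellikaan curve $\mathcal X_q$, i.e. $P\in\{O,X_\infty,Y_\infty\}$. Then the Weierstrass semigroup $H(P)$ of $\mathcal X_q$ at $P$ is the numerical semigroup generated by $$q+1,\ 2q+1,\ \ldots,\ (q+1)q+1,$$ that is, by the integers $nq+1$ with $1\le n\le q+1$.
   Context: $\mathbb K$ is the algebraic closure of $\mathbb F_q$. The Pellikaan curve $\mathcal X_q$ is the nonsingular plane projective curve over $\mathbb K$ with affine equation $xy^{q+1}+x^{q+1}+y=0$, i.e. with homogeneous equation $XY^{q+1}+X^{q+1}Z+YZ^{q+1}=0$ in coordinates $(X:Y:Z)$, $x=X/Z$, $y=Y/Z$; its function field is $\mathbb K(x,y)$ and its genus is $q(q+1)/2$. The base points of $\mathcal X_q$ are the vertices of the fundamental triangle, $O=(0:0:1)$, $X_\infty=(1:0:0)$, $Y_\infty=(0:1:0)$. The Weierstrass semigroup $H(P)$ is the set of integers $n\ge 0$ for which there is a rational function on the curve (over $\mathbb K$) with pole divisor exactly $nP$. *)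

(* Defs.v *)
From HB Require Import structures.
From mathcomp Require Import all_boot all_order all_algebra all_field.
From mathcomp Require Import ring.
From mathcomp.multinomials Require Import mpoly.

Set Implicit Arguments.
Unset Strict Implicit.
Unset Printing Implicit Defensive.

Import GRing.Theory.
Local Open Scope ring_scope.

Local Notation "x %:F" := (@FracField.tofrac _ x).

Lemma frac_quotient (R : idomainType) (a : {fraction R}) :
  exists n d : R, d != 0 /\ a = n%:F / d%:F.
Proof.
elim/quotW: a => r; exists (frac r).1, (frac r).2.
have d0 := denom_ratioP r; split=> //.
have dF0 : (frac r).2%:F != 0 by rewrite tofrac_eq0.
apply: (mulIf dF0); rewrite divfK //; unlock FracField.tofrac.
rewrite -[LHS]FracField.pi_mul; apply/eqmodP.
rewrite /= FracField.equivfE /FracField.mulf !numden_Ratio ?mulf_neq0 ?oner_neq0 //.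
by rewrite !mulr1 mulrC.
Qed.

Lemma clear_denominators (R : idomainType) (g : {poly {fraction R}}) :
  exists (c : R) (g0 : {poly R}),
    c != 0 /\ map_poly (@FracField.tofrac R) g0 = c%:F *: g.
Proof.
have aux (E : fieldType) (p : {poly E}) (c d n : E) : d != 0 ->
    d *: (c *: p) * 'X + (c * n)%:P = (c * d) *: (p * 'X + (n / d)%:P).
  move=> d0; rewrite scalerDr scalerA [d * c]mulrC -scalerAl; congr (_ + _).
  by rewrite -mul_polyC -polyCM -mulrA [d * _]mulrC divfK.
elim/poly_ind: g => [|g a [c [g0 [c0 Eg]]]].
  by exists 1, 0; rewrite oner_neq0 rmorph0 scaler0.
have [n [d [d0 ->]]] := frac_quotient a.
exists (c * d), (d *: g0 * 'X + (c * n)%:P); split; first by rewrite mulf_neq0.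
rewrite rmorphD rmorphM /= map_polyZ /= map_polyX map_polyC /= Eg.
by rewrite !tofracM aux // tofrac_eq0.
Qed.

(* The affine equation x y^(q+1) + x^(q+1) + y = 0, read as a polynomial in x
   with coefficients in K(y) = {fraction {poly K}}; it is monic once q > 0. *)
Definition pellikaan_poly (q : nat) (K : fieldType) :
    {poly {fraction {poly K}}} :=
  'X^(q.+1) + (('X : {poly K})%:F ^+ q.+1) *: 'X + (('X : {poly K})%:F)%:P.

(* Irreducibility of [pellikaan_poly]: it is checked along approximate branches
   (t, s(t)) of the curve at (0, 0), along which x has order 1 and y has order
   q + 1, so that 1, x, ..., x^q have orders distinct modulo q + 1. *)
Section Irreducibility.

Variables (q : nat) (K : fieldType).

Local Notation KY := {fraction {poly K}}.

Let f0 : {poly {poly K}} :=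
  'X^(q.+1) + (('X : {poly K}) ^+ q.+1) *: 'X + ('X : {poly K})%:P.

Let map_f0 : map_poly (@FracField.tofrac {poly K}) f0 = pellikaan_poly q K.
Proof.
by rewrite /f0 /pellikaan_poly !rmorphD /= map_polyXn map_polyZ /= map_polyX
           map_polyC rmorphXn.
Qed.

Let ev (s : {poly K}) (g : {poly {poly K}}) : {poly K} :=
  (map_poly (comp_poly s) g).['X].

Let evM s g h : ev s (g * h) = ev s g * ev s h.
Proof. by rewrite /ev rmorphM hornerM. Qed.

Let evZ s c g : ev s (c *: g) = (c \Po s) * ev s g.
Proof. by rewrite /ev map_polyZ hornerZ. Qed.

Let ev_f0 s : ev s f0 = 'X^(q.+1) + s ^+ q.+1 * 'X + s.
Proof.
rewrite /ev /f0 !rmorphD /= map_polyXn map_polyZ /= map_polyX map_polyC /=.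
by rewrite !hornerE rmorphXn /= comp_polyX.
Qed.

Let good (s : {poly K}) := exists2 u : {poly K}, u.[0] != 0 & s = 'X^(q.+1) * u.

Let coef_order (a : {poly K}) : a != 0 ->
  exists m, forall s, good s ->
    exists2 r : {poly K}, r.[0] != 0 & a \Po s = 'X^(q.+1 * m) * r.
Proof.
move=> a0; have [m [b rb Ea]] := multiplicity_XsubC a 0.
move: rb Ea; rewrite a0 /= subr0 => rb Ea; exists m => s [u u0 Es].
exists (u ^+ m * (b \Po s)).
  rewrite hornerM horner_exp mulf_neq0 ?expf_neq0 //.
  by rewrite horner_comp Es hornerM hornerXn expr0n mul0r.
rewrite {1}Ea comp_polyM rmorphXn /= comp_polyX {2}Es exprMn exprM; ring.
Qed.

Let ev_order (g : {poly {poly K}}) : g != 0 -> (size g <= q.+1)%N ->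
  exists W, forall s, good s ->
    exists2 r : {poly K}, r.[0] != 0 & ev s g = 'X^W * r.
Proof.
move=> g0 szg.
have evE s : ev s g = \sum_(i < q.+1) (g`_i \Po s) * 'X^i.
  rewrite /ev (@horner_coef_wide _ q.+1) ?(leq_trans (size_poly _ _)) //.
  by apply: eq_bigr => i _; rewrite coef_map.
suff H n : (n <= q.+1)%N -> (forall i, (i < n)%N -> g`_i = 0) \/
    exists W, (W %% q.+1 < n)%N /\ forall s, good s ->
    exists2 r : {poly K}, r.[0] != 0 &
      \sum_(i < n) (g`_i \Po s) * 'X^i = 'X^W * r.
  have [H0|[W [_ HW]]] := H _ (leqnn _).
    case/eqP: g0; apply/polyP => i; rewrite coef0.
    by have [/H0//|/(leq_trans szg)/leq_sizeP->] := ltnP i q.+1.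
  by exists W => s /HW; rewrite -evE.
elim: n => [_|n IHn ltn]; first by left.
have [gn0|/coef_order[m Hm]] := eqVneq g`_n 0.
  have [H0|[W [ltW HW]]] := IHn (ltnW ltn); [left|right].
    by move=> i; rewrite ltnS leq_eqVlt => /predU1P[->|/H0].
  exists W; split=> [|s /HW[r r0 Er]]; first exact: ltnW.
  by exists r; rewrite // big_ord_recr /= gn0 comp_poly0 mul0r addr0.
right; pose V := (q.+1 * m + n)%N.
have EV : (V %% q.+1)%N = n by rewrite /V mulnC modnMDl modn_small.
have [H0|[W [ltW HW]]] := IHn (ltnW ltn).
  exists V; split=> [|s /Hm[r r0 Er]]; first by rewrite EV.
  exists r => //; rewrite big_ord_recr big1 /= => [|i _]; last first.
    by rewrite H0 // comp_poly0 mul0r.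
  by rewrite add0r Er /V exprD mulrAC.
have lt_or : (W < V)%N || (V < W)%N.
  by rewrite -neq_ltn; apply: contraTneq ltW => ->; rewrite EV ltnn.
exists (minn W V); split=> [|s gs].
  by rewrite /minn; case: ifP => _; rewrite ?EV // ltnW.
have [r r0 Er] := Hm s gs; have [t t0 Et] := HW s gs.
rewrite big_ord_recr /= Et Er mulrAC -exprD -/V.
case/orP: lt_or => lt.
  exists (t + 'X^(V - W) * r); last first.
    by rewrite (minn_idPl (ltnW lt)) mulrDr mulrA -exprD subnKC // ltnW.
  by rewrite hornerD hornerM hornerXn expr0n subn_eq0 leqNgt lt mul0r addr0.
exists ('X^(W - V) * t + r); last first.
  by rewrite (minn_idPr (ltnW lt)) mulrDr mulrA -exprD subnKC // ltnW.
by rewrite hornerD hornerM hornerXn expr0n subn_eq0 leqNgt lt mul0r add0r.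
Qed.

Let branch N : exists s e, good s /\ ev s f0 = 'X^N * e.
Proof.
pose T (s : {poly K}) := - 'X^(q.+1) - 'X * s ^+ q.+1.
have goodT s : good s -> good (T s).
  case=> u u0 Es; exists (- 1 - 'X * (s ^+ q * u)).
    by rewrite hornerD !hornerN hornerM hornerX mul0r hornerC subr0 oppr_eq0 oner_neq0.
  by rewrite /T mulrBr mulrN1 [s ^+ _]exprSr {2}Es; congr (_ - _); ring.
have evT s : ev s f0 = s - T s by rewrite ev_f0 /T; ring.
elim: N => [|N [s [e [gs Es]]]].
  exists (- 'X^(q.+1)), (ev (- 'X^(q.+1)) f0); rewrite mul1r; split=> //.
  by exists (- 1); rewrite ?mulrN1 // hornerN hornerC oppr_eq0 oner_neq0.
exists (T s), (- (e * \sum_(i < q.+1) s ^+ (q - i) * T s ^+ i)).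
split; first exact: goodT.
have E : (s - T s) * (\sum_(i < q.+1) s ^+ (q - i) * T s ^+ i) =
         s ^+ q.+1 - T s ^+ q.+1.
  by rewrite subrXX; congr (_ * _); apply: eq_bigr => i _; rewrite subSS.
have -> : ev (T s) f0 = - ('X * (s ^+ q.+1 - T s ^+ q.+1)).
  by rewrite ev_f0 {2}/T; ring.
by rewrite -E -evT Es exprS; ring.
Qed.

Let size_lin : 
  (size ((('X : {poly K})%:F ^+ q.+1) *: 'X + (('X : {poly K})%:F)%:P)%R <= 2)%N.
Proof.
rewrite (leq_trans (size_polyD _ _)) // geq_max.
by rewrite (leq_trans (size_scale_leq _ _)) ?size_polyX //= (leq_trans (size_polyC_leq1 _)).
Qed.

Lemma pellikaan_poly_monic : (0 < q)%N -> pellikaan_poly q K \is monic.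
Proof.
move=> q0; rewrite /pellikaan_poly -addrA monicE lead_coefDl ?lead_coefXn //.
by rewrite size_polyXn (leq_ltn_trans size_lin).
Qed.

Lemma size_pellikaan_poly : (0 < q)%N -> size (pellikaan_poly q K) = q.+2.
Proof.
move=> q0; rewrite /pellikaan_poly -addrA size_polyDl ?size_polyXn //.
by rewrite (leq_ltn_trans size_lin).
Qed.

Lemma pellikaan_poly_irreducible :
  (0 < q)%N -> irreducible_poly (pellikaan_poly q K).
Proof.
move=> q0; have szf := size_pellikaan_poly q0.
split=> [|g szg /dvdpP[h Ef]]; first by rewrite szf.
have f_neq0 : pellikaan_poly q K != 0 by rewrite -size_poly_eq0 szf.
have := f_neq0; rewrite Ef mulf_eq0 negb_or => /andP[h_neq0 g_neq0].
have := szf; rewrite Ef size_mul // => szhg.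
have [h1|h_neq1] := eqVneq (size h) 1%N.
  by rewrite -dvdp_size_eqp ?dvdp_mull // size_mul // h1.
have g_gt1 : (1 < size g)%N by rewrite ltn_neqAle eq_sym szg size_poly_gt0.
have h_gt1 : (1 < size h)%N by rewrite ltn_neqAle eq_sym h_neq1 size_poly_gt0.
have [c [g1 [c0 Eg1]]] := clear_denominators g.
have [d [h1 [d0 Eh1]]] := clear_denominators h.
have inj : injective (@FracField.tofrac {poly K}).
  by move=> a b /eqP; rewrite tofrac_eq => /eqP.
have Egh : h1 * g1 = (d * c) *: f0.
  apply: (map_inj_poly inj (rmorph0 _)).
  rewrite rmorphM /= map_polyZ /= map_f0 Eg1 Eh1 Ef tofracM.
  by rewrite -scalerAl -scalerAr scalerA.
have szg1 : size g1 = size g.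
  by rewrite -(size_map_inj_poly inj (rmorph0 _)) Eg1 size_scale ?tofrac_eq0.
have szh1 : size h1 = size h.
  by rewrite -(size_map_inj_poly inj (rmorph0 _)) Eh1 size_scale ?tofrac_eq0.
have [||W HW] := @ev_order g1.
- by rewrite -size_poly_gt0 szg1 size_poly_gt0.
- by rewrite szg1 -ltnS -szhg; case: (size h) h_gt1 => [|[|n]] //= _; rewrite ltnS leq_addl.
have [||V HV] := @ev_order h1.
- by rewrite -size_poly_gt0 szh1 size_poly_gt0.
- by rewrite szh1 -ltnS -szhg addnC; case: (size g) g_gt1 => [|[|n]] //= _; rewrite ltnS leq_addl.
have [s [e [gs Ee]]] := branch (V + W).+1.
have [r r0 Er] := HW s gs; have [t t0 Et] := HV s gs.
have := congr1 (ev s) Egh; rewrite evM evZ Er Et Ee exprSr exprD => E.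
have {}E : 'X^(V + W) * (t * r) = 'X^(V + W) * ('X * (((d * c) \Po s) * e)).
  by rewrite exprD; move: E => /= E; transitivity ('X^V * t * ('X^W * r)); [ring | rewrite E; ring].
have Xn0 : 'X^(V + W) != 0 :> {poly K} by rewrite monic_neq0 ?monicXn.
have /(congr1 (horner^~ 0)) := mulfI Xn0 E.
by rewrite !hornerM hornerX mul0r => /eqP; rewrite mulf_eq0 (negPf r0) (negPf t0).
Qed.

End Irreducibility.

Lemma pellikaan_mi (F : finFieldType) (K : fieldType) :
  monic_irreducible_poly (pellikaan_poly #|F| K).
Proof.
have q0 : (0 < #|F|)%N by rewrite ltnW // finNzRing_gt1.
split; [exact: pellikaan_poly_irreducible | exact: pellikaan_poly_monic].
Qed.

Section Curve.

(* F serves only to provide q = #|F|. *)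
Variables (F : finFieldType) (K : fieldType).

Local Notation q := #|F|.

(* K(x, y), built as the extension of K(y) generated by a root x. *)
Definition funfield : fieldType := {poly %/ _ with pellikaan_mi F K}.

Definition fun_const : K -> funfield :=
  in_alg funfield \o @FracField.tofrac {poly K} \o polyC.

HB.instance Definition _ := GRing.RMorphism.on fun_const.

Definition fun_x : funfield := 'qX.
Definition fun_y : funfield := ('X : {poly K})%:F%:A.

Lemma fun_xyP : fun_x * fun_y ^+ q.+1 + fun_x ^+ q.+1 + fun_y = 0.
Proof.
pose g : {rmorphism {poly {fraction {poly K}}} -> funfield} :=
  in_qpoly (pellikaan_poly q K).
have E a : g a%:P = a%:A.
  by rewrite -alg_polyC [LHS]in_qpolyZ; congr (_ *: _); exact: in_qpoly1.
have <- : g (pellikaan_poly q K) = 0.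
  apply: val_inj; rewrite /= /mk_monic; have [mi mo] := pellikaan_mi F K.
  by rewrite mo andbT; case: mi => -> _; rewrite Pdiv.RingMonic.rmodpp.
rewrite /pellikaan_poly -mul_polyC !rmorphD rmorphM [in RHS]rmorphXn.
rewrite rmorphXn [g (_ ^+ _)]rmorphXn !E /= [RHS]addrAC.
by rewrite -[g 'X]/fun_x -/fun_y [in RHS]mulrC [in RHS]addrC addrA.
Qed.

(* Points of the projective plane are given by nonzero vectors of homogeneous
   coordinates (X, Y, Z); two of them are the same point when they span the
   same line, i.e. when (Q == P)%MS. *)
Definition pellikaan_form : {mpoly K[3]} :=
  'X_0 * 'X_1 ^+ q.+1 + 'X_0 ^+ q.+1 * 'X_2%R + 'X_1 * 'X_2%R ^+ q.+1.

Definition on_curve (Q : 'rV[K]_3) : bool :=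
  (Q != 0) && (pellikaan_form.@[Q 0] == 0).

Definition pt_O : 'rV[K]_3 := delta_mx 0 2.
Definition pt_Xoo : 'rV[K]_3 := delta_mx 0 0.
Definition pt_Yoo : 'rV[K]_3 := delta_mx 0 1.

(* A(x, y, 1), i.e. the function on the curve that a form A of degree d defines
   after division by Z^d. *)
Definition dehomog (A : {mpoly K[3]}) : funfield :=
  mmap fun_const (tnth [tuple fun_x; fun_y; 1]) A.

(* The local ring of the curve at Q. Since B does not vanish at the point Q of
   the curve, dehomog B is nonzero. *)
Definition regular_at (Q : 'rV[K]_3) (z : funfield) : Prop :=
  exists d (A B : {mpoly K[3]}),
    [/\ A \is d.-homog, B \is d.-homog, B.@[Q 0] != 0
      & z = dehomog A / dehomog B].

Definition local_unit (Q : 'rV[K]_3) (u : funfield) : Prop :=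
  [/\ u != 0, regular_at Q u & regular_at Q u^-1].

(* t generates the maximal ideal (the nonunits) of the local ring at Q. *)
Definition uniformizer (Q : 'rV[K]_3) (t : funfield) : Prop :=
  [/\ regular_at Q t, ~ local_unit Q t
    & forall s, regular_at Q s -> ~ local_unit Q s ->
        exists2 r, regular_at Q r & s = r * t].

Definition order_at (Q : 'rV[K]_3) (z : funfield) (m : int) : Prop :=
  exists t u, [/\ uniformizer Q t, local_unit Q u & z = u * t ^ m].

(* The coefficient of Q in the pole divisor of z is n: it is 0 where z is
   regular, and minus the order of z at the poles of z. *)
Definition pole_order_at (Q : 'rV[K]_3) (z : funfield) (n : nat) : Prop :=
  if n == 0%N then regular_at Q z else order_at Q z (- n%:Z).

Definition pole_divisor_at (P : 'rV[K]_3) (z : funfield) (n : nat) : Prop :=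
  forall Q, on_curve Q -> pole_order_at Q z (if (Q == P)%MS then n else 0%N).

Definition weierstrass_semigroup (P : 'rV[K]_3) (n : nat) : Prop :=
  exists z, pole_divisor_at P z n.

End Curve.

Definition generated_semigroup (s : seq nat) (n : nat) : Prop :=
  exists c : 'I_(size s) -> nat, n = (\sum_(i < size s) c i * nth 0 s i)%N.

(* Main.v *)
Require Import Defs.
From mathcomp Require Import all_boot all_order all_algebra all_field.
From mathcomp.multinomials Require Import mpoly.
From mathcomp Require Import ring zify.

(** Let [q] be the cardinal of [F], and consider the functions [x] and [y] with
    x y^(q+1) + x^(q+1) + y = 0. The pairs (y/x, 1/x) and (1/y, x/y), which are
    the affine coordinates near X_oo and Y_oo, satisfy the same equation
    ([nonconstant_pair_cycle]): the curve is invariant under the cyclic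
    permutation of X, Y and Z, which permutes the base points. It is therefore
    enough to treat one of them, and X_oo is the convenient one;
    [base_point_semigroup] does this for an arbitrary cyclic renaming of the
    homogeneous coordinates, so that no automorphism of the function field has
    to be built.

    Near the origin of a pair (s, t), the equation reads
    t (1 + s t^q) = - s^(q+1), where 1 + s t^q is a unit. So s generates the
    maximal ideal of the local ring, which is a discrete valuation ring where t
    has order q+1. What makes this meaningful is that a polynomial
    relation between s and t cannot have a nonzero constant term, because it is
    a multiple of the irreducible curve equation ([ev2_eq0_value]). Applied to
    the pairs above, this shows that x and y have orders -(q+1) and -q at X_oo,
    and q and -1 at Y_oo. Hence, for j <= q, x y^j is regular outside X_oo
    and has a pole of order (j+1) q + 1 at X_oo. This yields all the generators of the
    semigroup.

    Conversely, let z be regular outside X_oo. Being regular on the affine part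
    of the curve, it is a polynomial in x and y ([regular_affineP]). Replacing
    x y^(q+1) by - x^(q+1) - y as long as possible, one gets
    z = c(y) + P_0(x) + P_1(x) y + ... + P_q(x) y^q, where x divides P_j for
    j > 0 ([normal_form_ev2]). All terms but c(y) are regular at Y_oo, where a
    nonconstant polynomial in y has a pole; so c is constant. At X_oo the
    nonzero terms have poles of orders (q+1) deg P_j + q j, which are distinct
    modulo q+1, so that the order of the pole of z is one of them
    ([pole_order_Xoo]). As deg P_j > 0 when j > 0, this number is either 0 or
    (q+1) i + q j = (i - 1) (q+1) + ((j+1) q + 1) with i > 0 and j <= q, which is
    in the semigroup. *)

Import Order.TTheory GRing.Theory Num.Theory.
Local Open Scope ring_scope.
Set Implicit Arguments.
Unset Strict Implicit.
Unset Printing Implicit Defensive.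

(** * Orders in a local ring with principal maximal ideal *)

Section PrincipalLocalRing.

Variables (L : fieldType) (R : L -> Prop).

(** [lunit], [unif] and [ord] are [local_unit], [uniformizer] and [order_at],
    with an arbitrary subset [R] of the field in place of the local ring. *)
Definition lunit (u : L) := [/\ u != 0, R u & R u^-1].

Definition unif (t : L) :=
  [/\ R t, ~ lunit t
    & forall s, R s -> ~ lunit s -> exists2 r, R r & s = r * t].

Definition ord (z : L) (m : int) :=
  exists t u, [/\ unif t, lunit u & z = u * t ^ m].

(** [R] is a local ring with maximal ideal generated by [t]. If [R] is
    Noetherian, this is a discrete valuation ring; in general, an element that
    is divisible by all powers of [t] has no order in the sense of [has_order]. *)
Record principal_local_ring (t : L) : Prop := PrincipalLocalRing {
  vring1 : R 1;
  vringB : forall z w, R z -> R w -> R (z - w);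
  vringM : forall z w, R z -> R w -> R (z * w);
  vring_neq0 : t != 0;
  vring_unif : R t;
  vring_unifV : ~ R t^-1;
  vring_dec : forall z, R z -> lunit z \/ exists2 r, R r & z = r * t }.

Variable t : L.
Hypothesis vring_t : principal_local_ring t.

Let R1 := vring1 vring_t.
Let RB := vringB vring_t.
Let RM := vringM vring_t.
Let t0 := vring_neq0 vring_t.
Let Rt := vring_unif vring_t.
Let tN := vring_unifV vring_t.
Let Rdec := vring_dec vring_t.

(** Unlike in [ord], the uniformizer is fixed, which makes the orders of
    products and sums accessible. *)
Definition has_order (z : L) (m : int) := exists2 u, lunit u & z = u * t ^ m.

Lemma lunitM u v : lunit u -> lunit v -> lunit (u * v).
Proof.
by case=> ? ? ? [? ? ?]; split; rewrite ?mulf_neq0 ?invfM //; apply: RM.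
Qed.

Lemma lunitV u : lunit u -> lunit u^-1.
Proof. by case=> ? ? ?; split; rewrite ?invr_eq0 ?invrK. Qed.

Lemma lunit1 : lunit 1.
Proof. by split; rewrite ?oner_neq0 ?invr1. Qed.

Lemma lunit_exp u (m : int) : lunit u -> lunit (u ^ m).
Proof.
move=> Uu; have UX n : lunit (u ^+ n).
  elim: n => [|n IHn]; rewrite ?expr0 ?exprS; first exact: lunit1.
  exact: lunitM.
by case: m => n; [exact: UX | exact/lunitV/UX].
Qed.

Lemma vringD z w : R z -> R w -> R (z + w).
Proof.
move=> Rz Rw; have RN : R (0 - w) by rewrite -(subrr 1); do 2!apply: (RB) => //.
by rewrite -[w]opprK -[- w]sub0r; apply: RB.
Qed.

Lemma vringX z n : R z -> R (z ^+ n).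
Proof.
by move=> Rz; elim: n => [|n IHn]; rewrite ?expr0 ?exprS //; apply: RM.
Qed.

Lemma unif_vring : unif t.
Proof.
by split=> // [[_ _ /tN]//|s Rs nUs]; case: (Rdec Rs).
Qed.

Lemma has_order_ord z m : has_order z m -> ord z m.
Proof. by case=> u Uu ->; exists t, u; split; first exact: unif_vring. Qed.

(** Two uniformizers divide each other, so they differ by a unit. *)
Lemma ord_has_order z m : ord z m -> has_order z m.
Proof.
case=> s [u [[Rs nUs genS] Uu ->]].
have [r Rr Er] := genS _ Rt (fun U => tN (let: And3 _ _ h := U in h)).
have r0 : r != 0 by apply: contra_neq t0 => r0; rewrite Er r0 mul0r.
have s0 : s != 0 by apply: contra_neq t0 => s0; rewrite Er s0 mulr0.
have Ur : lunit r^-1.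
  case: (Rdec Rs) => [/nUs//|[r' Rr' Es]].
  have <- : r' = r^-1 by apply: (mulIf t0); rewrite -Es Er mulKf.
  split=> //; first by apply: contra_neq s0 => r'0; rewrite Es r'0 mul0r.
  suff -> : r'^-1 = r by [].
  have r'0 : r' != 0 by apply: contra_neq s0 => r'0; rewrite Es r'0 mul0r.
  apply: (mulfI r'0); rewrite divff //; apply: (mulIf s0).
  by rewrite -mulrA -Er -Es mul1r.
exists (u * r^-1 ^ m); first by apply: lunitM => //; apply: lunit_exp.
by rewrite -mulrA -expfzMl Er mulKf.
Qed.

(** Otherwise dividing the two expressions of [z] would make [t] invertible. *)
Lemma has_order_le z m m' : has_order z m -> has_order z m' -> (m' <= m)%R.
Proof.
case=> u Uu -> [u' Uu' E]; rewrite leNgt; apply/negP => lt.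
have {lt} [n En] : exists n : nat, m' = m + n.+1%:Z.
  by exists (`|m' - m|%N.-1); lia.
apply: tN; have E1 : t^-1 = u' * u^-1 * t ^+ n.
  have [[u0 _ _] [u'0 _ _]] := (Uu, Uu').
  have tm0 : t ^ m != 0 by rewrite expfz_neq0.
  have Eu : u = u' * t ^+ n.+1.
    by apply: (mulIf tm0); rewrite E En expfzDr // -mulrA [t ^ m * _]mulrC.
  have u0' := u0; rewrite Eu mulf_eq0 negb_or u'0 /= in u0'.
  by rewrite Eu exprSr; field; rewrite t0 u'0 expf_neq0.
have [[_ _ Vu] [_ Ru' _]] := (Uu, Uu').
by rewrite E1; apply: (RM); [apply: (RM) | apply: vringX].
Qed.

Lemma has_order_uniq z m m' : has_order z m -> has_order z m' -> m = m'.
Proof.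
move=> zm zm'; apply/eqP.
by rewrite eq_le (has_order_le zm' zm) (has_order_le zm zm').
Qed.

Lemma has_order1 : has_order 1 0.
Proof. by exists 1; rewrite ?mulr1 ?expr0z //; exact: lunit1. Qed.

Lemma has_orderM z w m n :
  has_order z m -> has_order w n -> has_order (z * w) (m + n).
Proof.
case=> u Uu -> [v Uv ->]; exists (u * v); first exact: lunitM.
by rewrite expfzDr // mulrACA.
Qed.

Lemma has_orderX z m n : has_order z m -> has_order (z ^+ n) (m * n%:Z).
Proof.
move=> vz; elim: n => [|n IHn]; first by rewrite expr0 mulr0; exact: has_order1.
by rewrite exprS (_ : m * n.+1 = m + m * n%:Z); [exact: has_orderM | lia].
Qed.

(** The sum is [t ^ m] times the sum of a unit and of a multiple of [t]; if the
    latter were a multiple of [t], so would be the unit. *)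
Lemma has_orderD z w m n :
  has_order z m -> has_order w n -> m < n -> has_order (z + w) m.
Proof.
case=> u Uu -> [v [v0 Rv _] ->] lt.
have [k ->] : exists k : nat, n = m + k.+1%:Z by exists (`|n - m|%N.-1); lia.
exists (u + v * t ^+ k.+1); last by rewrite expfzDr // mulrDl mulrAC mulrA.
have [u0 Ru Vu] := Uu.
have Rw : R (v * t ^+ k) by apply: RM => //; apply: vringX.
have RS : R (u + v * t ^+ k.+1).
  by rewrite exprSr mulrA; apply: vringD => //; apply: RM.
case: (Rdec RS) => // -[r Rr E].
case: tN; suff -> : t^-1 = u^-1 * (r - v * t ^+ k).
  by apply: RM => //; apply: RB.
apply: (mulIf t0); rewrite mulVf // -mulrA mulrBl -E -mulrA -exprSr addrK.
by rewrite mulVf.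
Qed.

Lemma has_orderV z m : has_order z m -> has_order z^-1 (- m).
Proof.
by case=> u Uu ->; exists u^-1; [exact: lunitV | rewrite invfM -invr_expz].
Qed.

Lemma has_order_neq0 z m : has_order z m -> z != 0.
Proof. by case=> u [u0 _ _] ->; rewrite mulf_neq0 ?expfz_neq0. Qed.

Lemma has_order_unif : has_order t 1.
Proof. by exists 1; rewrite ?expr1z ?mul1r //; exact: lunit1. Qed.

Lemma has_order_regular z m : has_order z m -> 0 <= m -> R z.
Proof.
by case: m => // n [u [_ Ru _] ->] _; apply: RM => //; exact: vringX.
Qed.

Lemma regular_order_ge0 z m : R z -> has_order z m -> 0 <= m.
Proof.
move=> Rz vz; rewrite leNgt; apply/negP => m0.
have [k Em] : exists k : nat, m = - k.+1%:Z by exists (`|m|%N.-1); lia.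
apply: tN; have [u [u0 Ru Vu] Ez] := vz.
suff -> : t^-1 = u^-1 * z * t ^+ k.
  by apply: (RM); [exact: (RM) | exact: vringX].
by rewrite Ez Em mulKf // -exprnN exprSr; field; rewrite expf_neq0 ?t0.
Qed.

End PrincipalLocalRing.

Lemma ord_ext (L : fieldType) (R R' : L -> Prop) z m :
  (forall z, R z <-> R' z) -> ord R z m -> ord R' z m.
Proof.
move=> RR' [t [u [[Rt nUt gen] [u0 Ru Vu] ->]]].
have lE v : lunit R' v <-> lunit R v by split=> -[v0 /RR' Rv /RR' Vv]; split.
exists t, u; split=> //; first split.
- exact/RR'.
- by move/lE.
- move=> s /RR' Rs nUs; have [|r /RR' Rr ->] := gen _ Rs; last by exists r.
  by move/lE.
- by split=> //; apply/RR'.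
Qed.

(** * Polynomials in two functions, and local rings *)

Section Evaluation.

Variables (K L : fieldType) (phi : {rmorphism K -> L}).

Definition ev1 (y : L) : {rmorphism {poly K} -> L} :=
  locked (horner_eval y \o map_poly phi : {rmorphism _ -> _}).

Lemma ev1E y c : ev1 y c = (map_poly phi c).[y].
Proof. by rewrite /ev1 -lock. Qed.

(** An element of [{poly {poly K}}] is read as a polynomial in x whose
    coefficients are polynomials in y, because the equation of the curve is
    monic in x. *)
Definition ev2 (x y : L) : {rmorphism {poly {poly K}} -> L} :=
  locked (horner_eval x \o map_poly (ev1 y) : {rmorphism _ -> _}).

Lemma ev2E x y g : ev2 x y g = (map_poly (ev1 y) g).[x].
Proof. by rewrite /ev2 -lock. Qed.

Lemma ev1C y c : ev1 y c%:P = phi c.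
Proof. by rewrite ev1E map_polyC hornerC. Qed.

Lemma ev1X y : ev1 y 'X = y.
Proof. by rewrite ev1E map_polyX hornerX. Qed.

Lemma ev2C x y c : ev2 x y c%:P = ev1 y c.
Proof. by rewrite ev2E map_polyC hornerC. Qed.

Lemma ev2X x y : ev2 x y 'X = x.
Proof. by rewrite ev2E map_polyX hornerX. Qed.

Lemma ev2Z x y c g : ev2 x y (c *: g) = ev1 y c * ev2 x y g.
Proof. by rewrite -mul_polyC rmorphM /= ev2C. Qed.

Definition evE := (ev1C, ev1X, ev2C, ev2X, ev2Z).

Definition value (a b : K) : {rmorphism {poly {poly K}} -> K} :=
  locked (horner_eval b \o horner_eval a%:P : {rmorphism _ -> _}).

Lemma valueE a b g : value a b g = g.[a%:P].[b].
Proof. by rewrite /value -lock. Qed.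

Lemma valueX a b : value a b 'X = a.
Proof. by rewrite valueE hornerX hornerC. Qed.

Lemma valueC a b c : value a b c%:P = c.[b].
Proof. by rewrite valueE hornerC. Qed.

(** The maximal ideal of (a, b) is generated by x - a and y - b. *)
Lemma value_taylor a b g : exists g1 g2,
  g = g1 * ('X - a%:P%:P) + (g2 * ('X - b%:P))%:P + (value a b g)%:P%:P.
Proof.
have [g1 E1] : exists g1, g - g.[a%:P]%:P = g1 * ('X - a%:P%:P).
  by apply/factor_theorem; rewrite /root !hornerE subrr.
have [g2 E2] : exists g2, g.[a%:P] - (g.[a%:P].[b])%:P = g2 * ('X - b%:P).
  by apply/factor_theorem; rewrite /root !hornerE subrr.
by exists g1, g2; rewrite valueE -E1 -E2 polyCB -addrA subrK subrK.
Qed.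

(** The local ring at (a, b), in the affine chart where the coordinate functions
    are [x] and [y]. *)
Definition local_ring (x y : L) (a b : K) (z : L) :=
  exists p r, value a b r != 0 /\ z = ev2 x y p / ev2 x y r.

Definition transcendental (y : L) := forall p, ev1 y p = 0 -> p = 0.

Variable q : nat.
Hypothesis q0 : (0 < q)%N.

(** [pellikaan_poly] with coefficients in K[y] instead of K(y). *)
Definition curve_poly : {poly {poly K}} :=
  'X^(q.+1) + ('X ^+ q.+1) *: 'X + 'X%:P.

Lemma map_curve_poly :
  map_poly (@FracField.tofrac {poly K}) curve_poly = pellikaan_poly q K.
Proof.
rewrite /curve_poly /pellikaan_poly !rmorphD /= map_polyXn map_polyZ /=.
by rewrite map_polyX map_polyC rmorphXn.
Qed.

Lemma tofrac_inj (R : idomainType) : injective (@FracField.tofrac R).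
Proof. by move=> a b /eqP; rewrite tofrac_eq => /eqP. Qed.

Lemma curve_poly_monic : curve_poly \is monic.
Proof.
apply/eqP/tofrac_inj.
rewrite -lead_coef_map_inj ?map_curve_poly ?tofrac1 ?tofrac0 //.
  exact/eqP/pellikaan_poly_monic.
exact: tofrac_inj.
Qed.

Definition pellikaan_pair (x y : L) := x * y ^+ q.+1 + x ^+ q.+1 + y = 0.

Lemma ev2_curve_poly x y : pellikaan_pair x y -> ev2 x y curve_poly = 0.
Proof.
move=> <-; rewrite /curve_poly !rmorphD /= ev2Z !rmorphXn /= !evE; ring.
Qed.

(** The remainder of [g] modulo the curve equation, if nonzero, is coprime to it
    over K(y) by irreducibility; clearing denominators in a Bezout relation
    gives a nonzero polynomial that vanishes at the transcendental [y]. So [g] is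
    a multiple of the equation, which has no constant term. *)
Lemma ev2_eq0_value x y g : pellikaan_pair x y -> transcendental y ->
  ev2 x y g = 0 -> value 0 0 g = 0.
Proof.
move=> fxy ty g0.
have Eg := Pdiv.RingMonic.rdivp_eq curve_poly_monic g.
set r := Pdiv.Ring.rmodp g _ in Eg.
have r0 : ev2 x y r = 0.
  by move: g0; rewrite Eg rmorphD rmorphM /= ev2_curve_poly // mulr0 add0r.
have [rz|rN0] := eqVneq r 0.
  rewrite Eg rz addr0 valueE /curve_poly !hornerE /=.
  by rewrite expr0n mulr0.
pose rF := map_poly (@FracField.tofrac {poly K}) r.
have irr := pellikaan_poly_irreducible K q0.
have cop : coprimep (pellikaan_poly q K) rF.
  apply/negPn/negP => ncop; have := irr.2 _ ncop (dvdp_gcdl _ _).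
  move=> Eg'; have := dvdp_gcdr (pellikaan_poly q K) rF.
  rewrite (eqp_dvdl _ Eg') => /dvdp_leq.
  rewrite map_poly_eq0_id0 ?tofrac_eq0 ?lead_coef_eq0 // => /(_ rN0).
  rewrite -map_curve_poly !(size_map_inj_poly (@tofrac_inj _) (rmorph0 _)).
  by rewrite leqNgt Pdiv.Ring.ltn_rmodpN0 // monic_neq0 // curve_poly_monic.
have [[u v] /= Euv] := Bezout_eq1_coprimepP _ _ cop.
have [c [u0 [c0 Eu]]] := clear_denominators u.
have [d [v0 [d0 Ev]]] := clear_denominators v.
have aux (A : comPzRingType) (c1 d1 u1 v1 f1 r1 : A) :
    d1 * (c1 * u1) * f1 + c1 * (d1 * v1) * r1 = c1 * d1 * (u1 * f1 + v1 * r1).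
  by ring.
have E : d%:P * u0 * curve_poly + c%:P * v0 * r = (c * d)%:P.
  apply: (map_inj_poly (@tofrac_inj _) (rmorph0 _)).
  rewrite rmorphD !rmorphM /= !map_polyC /= map_curve_poly -/rF Eu Ev.
  rewrite -!mul_polyC -[RHS]mulr1 -Euv; exact: aux.
have /(congr1 (ev2 x y)) := E; rewrite rmorphD !rmorphM /= ev2_curve_poly // r0.
rewrite !mulr0 addr0 !ev2C -rmorphM /= => /esym/ty/eqP.
by rewrite mulf_eq0 (negPf c0) (negPf d0).
Qed.

(** The last three conditions say that none of the ratios of the homogeneous
    coordinates (x : y : 1) is constant; this form is invariant under cyclic
    permutations of the coordinates. *)
Definition nonconstant_pair (x y : L) :=
  [/\ pellikaan_pair x y, forall c, x != phi c, forall c, y != phi c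
    & forall c, x != phi c * y].

Lemma local_ring_ev2 x y a b p : local_ring x y a b (ev2 x y p).
Proof. by exists p, 1; rewrite !rmorph1 oner_neq0 divr1. Qed.

Lemma local_ringM x y a b z w :
  local_ring x y a b z -> local_ring x y a b w -> local_ring x y a b (z * w).
Proof.
move=> [p [r [r0 ->]]] [p' [r' [r'0 ->]]]; exists (p * p'), (r * r').
by rewrite !rmorphM mulf_neq0 //= invfM mulrACA.
Qed.

Section Origin.

Variables s t : L.
Hypothesis mst : nonconstant_pair s t.
Hypothesis tt : transcendental t.

Let R := local_ring s t 0 0.

Let s0 : s != 0.
Proof. by have [_ /(_ 0) + _ _] := mst; rewrite rmorph0. Qed.

Let ev_neq0 r : value 0 0 r != 0 -> ev2 s t r != 0.
Proof. by apply: contra_neq => /ev2_eq0_value; apply=> //; case: mst. Qed.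

Lemma local_ring_unit p r : value 0 0 p != 0 -> value 0 0 r != 0 ->
  lunit R (ev2 s t p / ev2 s t r).
Proof.
move=> p0 r0; split; first by rewrite mulf_neq0 ?invr_eq0 ?ev_neq0.
  by exists p, r.
by exists r, p; rewrite invfM invrK mulrC.
Qed.

Lemma local_ring1 : R 1.
Proof. by rewrite -(rmorph1 (ev2 s t)); exact: local_ring_ev2. Qed.

Lemma local_ringB z w : R z -> R w -> R (z - w).
Proof.
move=> [p [r [r0 ->]]] [p' [r' [r'0 ->]]].
exists (p * r' - p' * r), (r * r'); rewrite rmorphM mulf_neq0 //; split=> //.
by rewrite rmorphB !rmorphM /=; field; rewrite !ev_neq0.
Qed.

Lemma local_ring_s : R s.
Proof. by rewrite -[s in R s](ev2X s t); exact: local_ring_ev2. Qed.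

(** The unit by which [t] and - s^(q+1) differ. *)
Definition unit_factor : L := 1 + s * t ^+ q.

Lemma unit_factorP : lunit R unit_factor.
Proof.
have -> : unit_factor = ev2 s t (1 + 'X * 'X%:P ^+ q) / ev2 s t 1.
  by rewrite rmorphD rmorphM rmorphXn /= !evE rmorph1 divr1.
apply: local_ring_unit; rewrite ?rmorph1 ?oner_neq0 //.
by rewrite rmorphD rmorphM rmorph1 /= valueX mul0r addr0 oner_neq0.
Qed.

Lemma t_unit_factor : t = - (unit_factor^-1 * s ^+ q.+1).
Proof.
have [w0 _ _] := unit_factorP; apply: (mulfI w0); rewrite mulrN mulVKf //.
have [E _ _ _] := mst; apply/eqP; rewrite -subr_eq0 opprK -E; apply/eqP.
by rewrite /unit_factor !exprS; ring.
Qed.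

(** If p / r were an inverse of [s], then s p - r would vanish although its
    constant term does not. *)
Lemma local_ring_sV : ~ R s^-1.
Proof.
case=> p [r [r0 E]]; have /negP[] := r0.
have : ev2 s t (p * 'X - r) = 0.
  rewrite rmorphB rmorphM /= ev2X; have -> : ev2 s t p = s^-1 * ev2 s t r.
    by rewrite E divfK ?ev_neq0.
  by rewrite mulrAC mulVf // mul1r subrr.
move/ev2_eq0_value; rewrite rmorphB rmorphM /= valueX mulr0 sub0r => E'.
by rewrite -oppr_eq0 E' //; case: mst.
Qed.

(** A numerator without constant term is a combination of [s] and [t], and [t]
    is a multiple of [s]. *)
Lemma local_ring_dec z : R z -> lunit R z \/ exists2 r, R r & z = r * s.
Proof.
case=> p [r [r0 ->]]; have [p0|p0] := eqVneq (value 0 0 p) 0; last first.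
  by left; apply: local_ring_unit.
right; have [p1 [p2 Ep]] := value_taylor 0 0 p.
have [_ _ wV] := unit_factorP.
have rV : R (ev2 s t r)^-1.
  exists 1, r; split=> //; by rewrite rmorph1 mul1r.
exists ((ev2 s t r)^-1 *
        (ev2 s t p1 - ev2 s t p2%:P * (unit_factor^-1 * s ^+ q))).
  apply: local_ringM => //; apply: local_ringB; first exact: local_ring_ev2.
  apply: local_ringM; first exact: local_ring_ev2.
  apply: local_ringM => //.
  rewrite -[s in s ^+ q](ev2X s t) -rmorphXn; exact: local_ring_ev2.
rewrite Ep p0 !polyC0 !subr0 addr0 polyCM rmorphD !rmorphM /= ev2X.
rewrite (ev2C s t 'X) ev1X.
set a := ev2 s t p1; set b := ev2 s t _; set c := _^-1.
by rewrite [t in LHS]t_unit_factor exprS; ring.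
Qed.

Lemma local_ring_vring : principal_local_ring R s.
Proof.
split; [exact: local_ring1 | exact: local_ringB |
  by move=> ? ?; exact: local_ringM | exact: s0 | exact: local_ring_s |
  exact: local_ring_sV | exact: local_ring_dec].
Qed.

Lemma has_order_t : has_order R s t q.+1%:Z.
Proof.
exists (- unit_factor^-1); last by rewrite mulNr; exact: t_unit_factor.
have [w0 Rw Vw] := unit_factorP; have R0 : R 0.
  by rewrite -(subrr 1); apply: local_ringB; exact: local_ring1.
split; first by rewrite oppr_eq0 invr_eq0.
  by rewrite -sub0r; exact: local_ringB.
by rewrite -invrN invrK -sub0r; exact: local_ringB.
Qed.

Lemma has_order_const c : c != 0 -> has_order R s (phi c) 0.
Proof.
move=> c0; exists (phi c); last by rewrite expr0z mulr1.
rewrite -[phi c]divr1 -(rmorph1 (ev2 s t)) -(ev1C t) -(ev2C s).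
by apply: local_ring_unit; rewrite ?rmorph1 ?oner_neq0 // valueC hornerC.
Qed.

(** When [w] has a pole, the leading term of a polynomial in [w] dominates. *)
Lemma has_order_ev1 w (k : nat) p : has_order R s w (- k.+1%:Z) -> p != 0 ->
  has_order R s (ev1 w p) (- (k.+1 * (size p).-1)%:Z).
Proof.
move=> vw; elim/poly_ind: p => [|p c IHp]; first by rewrite eqxx.
rewrite rmorphD rmorphM /= !evE size_MXaddC.
have [-> | p0 _] := eqVneq p 0; last rewrite /=.
  rewrite mul0r add0r polyC_eq0 /= => c0.
  rewrite (negPf c0) rmorph0 mul0r add0r size_poly0 muln0.
  exact: has_order_const.
have {}IHp := has_orderM local_ring_vring (IHp p0) vw.
have Ew : - (k.+1 * (size p).-1)%:Z + - k.+1%:Z = - (k.+1 * size p)%:Z.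
  by have := size_poly_gt0 p; rewrite p0; case: (size p) => //= n _; lia.
rewrite Ew in IHp; have [->|c0] := eqVneq c 0; first by rewrite rmorph0 addr0.
apply: (has_orderD local_ring_vring) IHp (has_order_const c0) _.
by have := size_poly_gt0 p; rewrite p0; lia.
Qed.

End Origin.
End Evaluation.

(** * Functions that are regular on the affine curve *)

Section AffineRing.

Variables (K L : fieldType) (phi : {rmorphism K -> L}).

Definition split_field (E : fieldType) := forall p : {poly E},
  exists rs, p = lead_coef p *: \prod_(a <- rs) ('X - a%:P).

Hypothesis splitK : split_field K.

Lemma nonconstant_transcendental y :
  (forall c, y != phi c) -> transcendental phi y.
Proof.
move=> yN p; have [rs ->] := splitK p.
rewrite -mul_polyC rmorphM rmorph_prod /= ev1C => /eqP.
rewrite mulf_eq0 fmorph_eq0 => /orP[/eqP->|]; first by rewrite mul0r.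
rewrite prodf_seq_eq0 => /hasP[c _] /=; rewrite rmorphB /= ev1X ev1C subr_eq0.
by rewrite (negPf (yN c)).
Qed.

Variable q : nat.
Hypothesis q0 : (0 < q)%N.

(** From the chart (X/Z, Y/Z) to the chart (Y/X, Z/X). *)
Lemma nonconstant_pair_cycle x y :
  nonconstant_pair phi q x y -> nonconstant_pair phi q (y / x) x^-1.
Proof.
case=> E xN yN xyN; have x0 : x != 0 by have := xN 0; rewrite rmorph0.
have y0 : y != 0 by have := yN 0; rewrite rmorph0.
split=> [|c|c|c].
- apply: (mulIf (expf_neq0 q.+2 x0)); rewrite mul0r -[RHS]E !exprS !expr_div_n.
  by rewrite exprVn; field; rewrite expf_neq0 ?x0.
- have [->|c0] := eqVneq c 0; first by rewrite rmorph0 mulf_neq0 ?invr_eq0.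
  apply: contra_neq (xyN c^-1) => Ey.
  by rewrite -[y](divfK x0) Ey fmorphV mulKf // fmorph_eq0.
- by apply: contra_neq (xN c^-1) => Ex; rewrite fmorphV -Ex invrK.
- by apply: contra_neq (yN c) => Ey; apply: (mulIf (invr_neq0 x0)).
Qed.

Lemma nonconstant_pair_cycle2 x y :
  nonconstant_pair phi q x y -> nonconstant_pair phi q y^-1 (x / y).
Proof.
move=> M; have := nonconstant_pair_cycle (nonconstant_pair_cycle M).
have [_ /(_ 0) + _ _] := M; rewrite rmorph0 => x0.
by rewrite !invf_div mulrA mulVf // mul1r.
Qed.

Variables x y : L.
Hypothesis fxy : pellikaan_pair q x y.

(** The ring K[x, y]. *)
Let A z := exists p, z = ev2 phi x y p.

Let AB z w : A z -> A w -> A (z - w).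
Proof. by move=> [p ->] [r ->]; exists (p - r); rewrite rmorphB. Qed.

Let AM z w : A z -> A w -> A (z * w).
Proof. by move=> [p ->] [r ->]; exists (p * r); rewrite rmorphM. Qed.

Let Aev p : A (ev2 phi x y p). Proof. by exists p. Qed.

Let A1 c : A (ev1 phi y c). Proof. by exists c%:P; rewrite ev2C. Qed.

Let AC c : A (phi c). Proof. by rewrite -(ev1C phi y); exact: A1. Qed.

Lemma integral_ev2 p : integralOver (ev1 phi y) (ev2 phi x y p).
Proof.
rewrite ev2E; apply: integral_horner.
  apply/integral_poly => i; rewrite coef_map; exact: integral_id.
exists (curve_poly K q); first exact: curve_poly_monic.
by apply/eqP; rewrite -ev2E ev2_curve_poly.
Qed.

(** The element [b] of K[x, y] is integral over K[y]. In an equation of integral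
    dependence, after division by a power of [b], the constant coefficient is
    nonzero, and it is a multiple of [b]. *)
Lemma multiple_in_Ky p : ev2 phi x y p != 0 ->
  exists2 d, d != 0 & exists g, ev1 phi y d = ev2 phi x y g * ev2 phi x y p.
Proof.
set b := ev2 phi x y p => b0; have [m mm /eqP] := integral_ev2 p.
rewrite -/b -ev2E; have : m != 0 by apply: monic_neq0.
elim/poly_ind: m {mm} => [|m c IHm]; first by rewrite eqxx.
rewrite rmorphD rmorphM /= ev2C ev2X.
have [->|c0] := eqVneq c 0.
  rewrite addr0 rmorph0 addr0 mulf_eq0 polyX_eq0 orbF => m0 /eqP.
  by rewrite mulf_eq0 (negPf b0) orbF => /eqP; apply: IHm.
move=> _ /eqP; rewrite addrC addr_eq0 => /eqP Ec.
exists c => //; rewrite Ec -mulNr.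
have [g ->] : A (- ev2 phi b y m); last by exists g.
elim/poly_ind: m {IHm Ec} => [|m e [g Eg]].
  by rewrite rmorph0 oppr0; exists 0; rewrite rmorph0.
rewrite rmorphD rmorphM /= ev2C ev2X opprD -mulNr Eg.
by apply: AB; [apply: AM; exact: Aev | exact: A1].
Qed.

Definition regular_affine z := forall a b,
  value a b (curve_poly K q) = 0 -> local_ring phi x y a b z.

Lemma regular_affineM z w :
  regular_affine z -> regular_affine w -> regular_affine (z * w).
Proof.
by move=> rz rw a b fab; apply: local_ringM; [exact: rz | exact: rw].
Qed.

Lemma regular_affine_ev2 p : regular_affine (ev2 phi x y p).
Proof. by move=> a b _; exact: local_ring_ev2. Qed.

(** If (a, b) is on the curve, [z] has a denominator [g] in K[x, y] with
    g(a, b) != 0; if not, the curve equation itself plays this role, since it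
    vanishes in the function field. The hypotheses allow to replace [g] by the
    constant g(a, b). *)
Lemma regular_at_point a b z : regular_affine z ->
  A ((x - phi a) * z) -> A ((y - phi b) * z) -> A z.
Proof.
move=> rz Az Bz.
suff [g g0 Ag] : exists2 g, value a b g != 0 & A (ev2 phi x y g * z).
  have [g1 [g2 Eg]] := value_taylor a b g.
  have e0 : phi (value a b g) != 0 by rewrite fmorph_eq0.
  have {Ag} : A (phi (value a b g) * z).
    move: Ag; rewrite {1}Eg !rmorphD !rmorphM /= !rmorphB /= !evE => Ag.
    set u := ev2 phi x y g1 in Ag *; set w := ev1 phi y g2 in Ag *.
    set e := phi (value a b g) in Ag *.
    have -> : e * z = (u * (x - phi a) + w * (y - phi b) + e) * z -
        u * ((x - phi a) * z) - w * ((y - phi b) * z) by ring.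
    apply: AB; last by apply: AM => //; exact: A1.
    by apply: AB => //; apply: AM => //; exact: Aev.
  by move/(AM (AC (value a b g)^-1)); rewrite fmorphV mulKf.
have [/rz|nf] := eqVneq (value a b (curve_poly K q)) 0; last first.
  exists (curve_poly K q) => //.
  rewrite ev2_curve_poly // mul0r -(subrr (phi 0)); exact: AB.
case=> p [r [r0 ->]]; have [rz0|rz0] := eqVneq (ev2 phi x y r) 0.
  by exists r; rewrite // rz0 mul0r; exists 0; rewrite rmorph0.
by exists r; rewrite // mulrC divfK //; exact: Aev.
Qed.

(** Subtracting its restriction to the line y = b makes [g] divisible by
    y - b. *)
Lemma mod_y_sub b (g : {poly {poly K}}) : exists g',
  g = ('X - b%:P)%:P * g' + map_poly polyC (map_poly (horner_eval b) g).
Proof.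
elim/poly_ind: g => [|g c [g' Eg]].
  by exists 0; rewrite !rmorph0 mulr0 addr0.
have [c' Ec] : exists c', c - (c.[b])%:P = c' * ('X - b%:P).
  by apply/factor_theorem; rewrite /root !hornerE subrr.
exists (g' * 'X + c'%:P); rewrite !rmorphD !rmorphM /= !map_polyX !map_polyC /=.
rewrite {1}Eg -[c in LHS](subrK (c.[b])%:P) Ec [(_ * _ + _)%:P]polyCD polyCM.
by ring.
Qed.

Lemma ev2_map_polyC h : ev2 phi x y (map_poly polyC h) = ev1 phi x h.
Proof.
rewrite ev1E ev2E -map_poly_comp; congr _.[_].
by apply: eq_map_poly => c /=; rewrite ev1C.
Qed.

(** Modulo y - b, the curve equation becomes a product of factors x - a, which
    is thus a denominator of [z]; [regular_at_point] removes them one by one. *)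
Lemma regular_on_line b z : regular_affine z -> A ((y - phi b) * z) -> A z.
Proof.
move=> rz Bz; pose h := map_poly (horner_eval b) (curve_poly K q).
have [rs Eh] := splitK h.
have hm : lead_coef h = 1.
  by apply/eqP; rewrite -monicE; apply: monic_map; exact: curve_poly_monic.
have {Eh} Eh : ev1 phi x h = \prod_(a <- rs) (x - phi a).
  rewrite Eh hm scale1r rmorph_prod /=; apply: eq_bigr => a _.
  by rewrite rmorphB /= !evE.
have : A (\prod_(a <- rs) (x - phi a) * z).
  have [g Eg] := mod_y_sub b (curve_poly K q).
  have := congr1 (ev2 phi x y) Eg; rewrite ev2_curve_poly // rmorphD rmorphM /=.
  rewrite ev2_map_polyC -Eh ev2C rmorphB /= !evE -/h => /eqP.
  rewrite eq_sym addrC addr_eq0 => /eqP->.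
  rewrite [X in A X](_ : _ = phi 0 - ev2 phi x y g * ((y - phi b) * z)).
    by apply: AB => //; apply: AM => //; exact: Aev.
  by rewrite rmorph0; ring.
elim: rs z rz Bz {Eh} => [|a rs IHrs] z rz Bz; first by rewrite big_nil mul1r.
rewrite big_cons -mulrA mulrCA => Az.
have Exa : x - phi a = ev2 phi x y ('X - a%:P%:P) by rewrite rmorphB /= !evE.
have Axa : A (x - phi a) by rewrite Exa; exact: Aev.
apply: (@regular_at_point a b) => //; apply: IHrs.
- by rewrite Exa; apply: regular_affineM => //; exact: regular_affine_ev2.
- by rewrite mulrCA; exact: AM.
- by [].
Qed.

(** Some nonzero polynomial in [y] is a denominator of [z]; it is a product of
    factors y - b, which [regular_on_line] removes one by one. *)
Lemma regular_affineP z : regular_affine z -> exists p, z = ev2 phi x y p.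
Proof.
move=> rz; have [d d0 Adz] : exists2 d, d != 0 & A (ev1 phi y d * z).
  (* any point of the curve gives a first denominator *)
  have f00 : value 0 0 (curve_poly K q) = 0.
    rewrite /curve_poly !rmorphD /= -mul_polyC rmorphM !rmorphXn /= valueX.
    by rewrite !valueC hornerX mulr0 expr0n !addr0.
  have [p [r [r0 Ez]]] := rz _ _ f00.
  have [er0|er0] := eqVneq (ev2 phi x y r) 0.
    exists 1; rewrite ?oner_neq0 // Ez er0 invr0 !mulr0 -(rmorph0 phi).
    exact: AC.
  have [d d0 [g Eg]] := multiple_in_Ky er0; exists d => //.
  by rewrite Ez Eg mulrACA divff // mulr1; apply: AM; exact: Aev.
have [rs Ed] := splitK d.
have {Adz Ed} : A (\prod_(b <- rs) (y - phi b) * z).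
  have l0 : phi (lead_coef d) != 0 by rewrite fmorph_eq0 lead_coef_eq0.
  suff -> : \prod_(b <- rs) (y - phi b) = phi (lead_coef d)^-1 * ev1 phi y d.
    by rewrite -mulrA; apply: AM.
  rewrite {2}Ed -mul_polyC rmorphM /= ev1C fmorphV mulKf // rmorph_prod /=.
  by apply: eq_bigr => b _; rewrite rmorphB /= !evE.
elim: rs z rz => [|b rs IHrs] z rz; first by rewrite big_nil mul1r.
rewrite big_cons -mulrA mulrCA => Az; apply: (@regular_on_line b) => //.
apply: IHrs => //.
have -> : y - phi b = ev2 phi x y ('X - b%:P)%:P.
  by rewrite ev2C rmorphB /= !evE.
by apply: regular_affineM => //; exact: regular_affine_ev2.
Qed.

End AffineRing.

(** * The numerical semigroup *)

Lemma generated_semigroup0 s : generated_semigroup s 0.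
Proof. by exists (fun=> 0%N); rewrite big1 // => i _; rewrite mul0n. Qed.

Lemma generated_semigroupD s m n :
  generated_semigroup s m -> generated_semigroup s n ->
  generated_semigroup s (m + n).
Proof.
move=> [c ->] [d ->]; exists (fun i => c i + d i)%N.
by rewrite -big_split /=; apply: eq_bigr => i _; rewrite mulnDl.
Qed.

Lemma generated_semigroup_mem s n : n \in s -> generated_semigroup s n.
Proof.
move=> sn; have lt : (index n s < size s)%N by rewrite index_mem.
exists (fun i => (i == Ordinal lt) : nat); rewrite (bigD1 (Ordinal lt)) //=.
by rewrite eqxx mul1n nth_index // big1 ?addn0 // => i /negPf->.
Qed.

Lemma generated_semigroup_mull s k n :
  generated_semigroup s n -> generated_semigroup s (k * n).
Proof.
move=> sn; elim: k => [|k IHk]; first exact: generated_semigroup0.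
by rewrite mulSn; exact: generated_semigroupD.
Qed.

Lemma generated_semigroup_ind s (P : nat -> Prop) :
  P 0%N -> (forall m n, P m -> P n -> P (m + n)%N) ->
  (forall n, n \in s -> P n) -> forall n, generated_semigroup s n -> P n.
Proof.
move=> P0 PD Ps n [c ->]; apply: (big_ind P) => // i _.
by elim: (c i) => [|k IHk] //; rewrite mulSn; apply: PD => //; apply/Ps/mem_nth.
Qed.

Definition base_semigroup q :=
  generated_semigroup [seq (k * q + 1)%N | k <- iota 1 q.+1].

(** The orders at X_oo of the poles of the monomials x^i y^j that are regular
    everywhere else. *)
Lemma base_semigroup_pole q i j : (j <= q)%N -> (j = 0%N \/ 0 < i)%N ->
  base_semigroup q (q.+1 * i + q * j).
Proof.
have gen k : (k <= q)%N -> base_semigroup q (k.+1 * q + 1).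
  move=> lekq; apply: generated_semigroup_mem; apply/mapP; exists k.+1 => //.
  by rewrite mem_iota; lia.
move=> lejq [->|].
  have -> : (q.+1 * i + q * 0 = i * (1 * q + 1))%N by lia.
  exact/generated_semigroup_mull/gen.
case: i => // i _.
have -> : (q.+1 * i.+1 + q * j = i * (1 * q + 1) + (j.+1 * q + 1))%N by nia.
apply: generated_semigroupD; last exact: gen.
exact/generated_semigroup_mull/gen.
Qed.

(** * Functions whose only pole is at X_oo *)

Section PoleOrders.

Variables (K L : fieldType) (phi : {rmorphism K -> L}).
Hypothesis splitK : split_field K.
Variable q : nat.
Hypothesis q0 : (0 < q)%N.
Variables x y : L.
Hypothesis Mxy : nonconstant_pair phi q x y.

Definition at_Xoo := local_ring phi (y / x) x^-1 0 0.
Definition at_Yoo := local_ring phi y^-1 (x / y) 0 0.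

Let fxy : pellikaan_pair q x y. Proof. by case: Mxy. Qed.
Let x0 : x != 0. Proof. by have [_ /(_ 0) + _ _] := Mxy; rewrite rmorph0. Qed.
Let y0 : y != 0. Proof. by have [_ _ /(_ 0) + _] := Mxy; rewrite rmorph0. Qed.

Let Mst := nonconstant_pair_cycle Mxy.

Let Mst' := nonconstant_pair_cycle2 Mxy.

Let tt : transcendental phi x^-1.
Proof. by apply: nonconstant_transcendental => //; case: Mst. Qed.

Let tt' : transcendental phi (x / y).
Proof. by apply: nonconstant_transcendental => //; case: Mst'. Qed.

Lemma at_Xoo_vring : principal_local_ring at_Xoo (y / x).
Proof. exact: (local_ring_vring q0 Mst tt). Qed.

Lemma at_Yoo_vring : principal_local_ring at_Yoo y^-1.
Proof. exact: (local_ring_vring q0 Mst' tt'). Qed.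

Let ordX := has_order at_Xoo (y / x).
Let ordY := has_order at_Yoo y^-1.

Lemma order_x_Xoo : ordX x (- q.+1%:Z).
Proof.
by have := has_orderV (has_order_t q0 Mst tt); rewrite invrK.
Qed.

Lemma order_y_Xoo : ordX y (- q%:Z).
Proof.
have := has_orderM at_Xoo_vring (has_order_unif at_Xoo_vring) order_x_Xoo.
by rewrite divfK // (_ : 1 + _ = - q%:Z); last lia.
Qed.

Lemma order_y_Yoo : ordY y (- 1).
Proof.
by have := has_orderV (has_order_unif at_Yoo_vring); rewrite invrK.
Qed.

Lemma order_x_Yoo : ordY x q.
Proof.
have := has_orderM at_Yoo_vring (has_order_t q0 Mst' tt') order_y_Yoo.
by rewrite divfK // (_ : _ + _ = q%:Z); last lia.
Qed.

Lemma order_xyn_Xoo j : ordX (x * y ^+ j) (- (j.+1 * q + 1)%N%:Z).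
Proof.
have oyj := has_orderX at_Xoo_vring j order_y_Xoo.
have := has_orderM at_Xoo_vring order_x_Xoo oyj.
by rewrite (_ : _ + _ = - (j.+1 * q + 1)%N%:Z); last lia.
Qed.

Lemma regular_xyn_Yoo j : (j <= q)%N -> at_Yoo (x * y ^+ j).
Proof.
have oyj := has_orderX at_Yoo_vring j order_y_Yoo.
have oxyj := has_orderM at_Yoo_vring order_x_Yoo oyj.
by move=> lejq; apply: (has_order_regular at_Yoo_vring oxyj); lia.
Qed.

Definition normal_form z := exists c P,
  z = ev1 phi y c + \sum_(j < q.+1) ev1 phi x (P (j : nat)) * y ^+ j /\
  (forall j, (0 < j)%N -> (P j).[0] = 0).

Lemma normal_formD z w : normal_form z -> normal_form w -> normal_form (z + w).
Proof.
move=> [c [P [-> P0]]] [d [Q [-> Q0]]]; exists (c + d), (fun j => P j + Q j).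
split; last by move=> j j0; rewrite hornerD P0 ?Q0 ?addr0.
rewrite rmorphD /= addrACA -big_split; congr (_ + _).
by apply: eq_bigr => j _; rewrite rmorphD mulrDl.
Qed.

Lemma normal_formZ a z : normal_form z -> normal_form (phi a * z).
Proof.
move=> [c [P [-> P0]]]; exists (a%:P * c), (fun j => a%:P * P j).
split; last by move=> j j0; rewrite hornerM P0 ?mulr0.
rewrite rmorphM /= ev1C mulrDr mulr_sumr; congr (_ + _).
by apply: eq_bigr => j _; rewrite rmorphM /= ev1C mulrA.
Qed.

(** By the curve equation, x^(i+1) y^(k+q+1) = - x^(i+q+1) y^k - x^i y^(k+1):
    the exponent of [y] decreases in both terms. *)
Lemma normal_form_monomial i j : normal_form (x ^+ i * y ^+ j).
Proof.
elim/ltn_ind: j i => j IHj [|i].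
  exists 'X^j, (fun=> 0); split; last by move=> *; rewrite horner0.
  rewrite mul1r rmorphXn /= ev1X big1 ?addr0 // => k _.
  by rewrite rmorph0 mul0r.
have [lejq|ltqj] := leqP j q.
  exists 0, (fun k => if k == j then 'X^(i.+1) else 0 : {poly K}).
  split; last first.
    by move=> k _; case: eqP; rewrite ?horner0 // hornerXn expr0n.
  rewrite rmorph0 add0r (bigD1 (Ordinal (lejq : (j < q.+1)%N))) //= eqxx.
  rewrite rmorphXn /= ev1X big1 ?addr0 // => k.
  by rewrite -val_eqE /= => /negPf->; rewrite rmorph0 mul0r.
have [k Ej] : exists k, j = (q.+1 + k)%N by exists (j - q.+1)%N; lia.
have -> : x ^+ i.+1 * y ^+ j =
    phi (-1) * (x ^+ (i + q.+1) * y ^+ k) + phi (-1) * (x ^+ i * y ^+ k.+1).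
  rewrite rmorphN1 !mulN1r; apply/eqP; rewrite -opprD -addr_eq0 Ej; apply/eqP.
  rewrite -[RHS](mulr0 (x ^+ i * y ^+ k)) -fxy !exprD !exprS; ring.
by apply: normal_formD; apply: normal_formZ; apply: IHj; lia.
Qed.

Lemma normal_form_ev2 p : normal_form (ev2 phi x y p).
Proof.
have normal_form0 : normal_form 0
  by have := normal_formZ 0 (normal_form_monomial 0 0); rewrite rmorph0 mul0r.
have nf1 c j i : normal_form (ev1 phi y c * (x ^+ i * y ^+ j)).
  elim/poly_ind: c j => [|c a IHc] j; first by rewrite rmorph0 mul0r.
  rewrite rmorphD rmorphM /= !evE mulrDl; apply: normal_formD.
    by rewrite -mulrA [y * _]mulrCA -exprS.
  exact/normal_formZ/normal_form_monomial.
suff nf2 i : normal_form (ev2 phi x y p * x ^+ i).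
  by rewrite -[ev2 _ _ _ _]mulr1 -(expr0 x).
elim/poly_ind: p i => [|p c IHp] i; first by rewrite rmorph0 mul0r.
rewrite rmorphD rmorphM /= !evE mulrDl -mulrA -exprS; apply: normal_formD => //.
by rewrite -[x ^+ i]mulr1 -(expr0 y).
Qed.

(** All terms but the polynomial c(y) are regular at Y_oo, so c(y) is regular
    too and c is constant; it is then absorbed by the term of index 0. *)
Lemma regular_Yoo_normal_form z : normal_form z -> at_Yoo z -> exists P,
  z = \sum_(j < q.+1) ev1 phi x (P (j : nat)) * y ^+ j /\
  (forall j, (0 < j)%N -> (P j).[0] = 0).
Proof.
move=> [c [P [-> P0]]].
have regular_poly_x p : at_Yoo (ev1 phi x p).
  elim/poly_ind: p => [|p a IHp].
    rewrite rmorph0 -(subrr 1).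
    by apply: (vringB at_Yoo_vring); exact: (vring1 at_Yoo_vring).
  rewrite rmorphD rmorphM /= !evE; apply: (vringD at_Yoo_vring).
    apply: (vringM at_Yoo_vring) => //.
    exact: (has_order_regular at_Yoo_vring order_x_Yoo).
  rewrite -(ev1C phi (x / y)) -(ev2C phi y^-1); exact: local_ring_ev2.
set S := \sum_(j < q.+1) _; have RS : at_Yoo S.
  apply: (big_ind at_Yoo) => [||j _].
  - by rewrite -(rmorph0 (ev1 phi x)).
  - exact: (vringD at_Yoo_vring).
  have [j0|/P0 Pj0] := posnP j; first by rewrite j0 mulr1.
  have [p Ep] : exists p, P j = p * ('X - 0%:P).
    by apply/factor_theorem; rewrite /root Pj0.
  rewrite Ep polyC0 subr0 rmorphM /= ev1X -mulrA.
  by apply: (vringM at_Yoo_vring) => //; apply: regular_xyn_Yoo; rewrite -ltnS.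
move=> Rz; have Rc : at_Yoo (ev1 phi y c).
  by rewrite -[ev1 phi y c](addrK S); apply: (vringB at_Yoo_vring).
have [a ->] : exists a, c = a%:P.
  have [->|c0] := eqVneq c 0; first by exists 0; rewrite polyC0.
  exists c`_0; apply: size1_polyC.
  have oc := has_order_ev1 q0 Mst' tt' (k := 0) order_y_Yoo c0.
  have := regular_order_ge0 at_Yoo_vring Rc oc.
  by case: (size c) => [|[|m]] //; lia.
exists (fun j => if j == 0%N then P j + a%:P else P j); split; last first.
  by case=> // j /P0.
rewrite /S !big_ord_recl /= [ev1 phi x (_ + _)]rmorphD /= !ev1C !mulr1 addrA.
by congr (_ + _); rewrite addrC.
Qed.

(** The order of the pole of P_j(x) y^j is congruent to - j modulo q + 1, so
    that no two terms of the sum can cancel each other. *)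
Lemma pole_order_Xoo P m : (m <= q.+1)%N ->
  (forall j, (0 < j)%N -> (P j).[0] = 0) ->
  let z := \sum_(j < m) ev1 phi x (P (j : nat)) * y ^+ j in
  z = 0 \/ exists i j, [/\ (j < m)%N, j = 0%N \/ (0 < i)%N
    & ordX z (- (q.+1 * i + q * j)%N%:Z)].
Proof.
move=> + P0 /=; elim: m => [|m IHm] lemq; first by left; rewrite big_ord0.
rewrite big_ord_recr /=; have [Pm0|Pm0] := eqVneq (P m) 0.
  rewrite Pm0 rmorph0 mul0r addr0.
  have [|[i [j [ltjm ij Hz]]]] := IHm (ltnW lemq); first by left.
  by right; exists i, j; split=> //; exact: ltnW.
right; set w := ev1 _ _ _ * _; pose i := (size (P m)).-1.
have im : m = 0%N \/ (0 < i)%N.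
  have [|m0] := posnP m; [by left | right]; rewrite /i; have := P0 _ m0.
  move: Pm0; rewrite -size_poly_gt0; case Es: (size (P m)) => [|[|s]] // _.
  have /eqP/size_poly1P[a a0 ->] := Es.
  by rewrite hornerC => a_eq0; rewrite a_eq0 eqxx in a0.
have ow : ordX w (- (q.+1 * i + q * m)%N%:Z).
  have oP := has_order_ev1 q0 Mst tt order_x_Xoo Pm0.
  have := has_orderM at_Xoo_vring oP (has_orderX at_Xoo_vring m order_y_Xoo).
  by rewrite (_ : _ + _ = - (q.+1 * i + q * m)%N%:Z) //; rewrite /i; lia.
have [->|[i' [j [ltjm ij Hz]]]] := IHm (ltnW lemq).
  by exists i, m; rewrite add0r; split.
have : (q.+1 * i + q * m != q.+1 * i' + q * j)%N.
  apply/eqP => E.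
  have : ((i + m) * q.+1 + j = (i' + j) * q.+1 + m)%N by nia.
  by move/(congr1 (modn^~ q.+1)); rewrite !modnMDl !modn_small => [ejm||]; lia.
rewrite neq_ltn => /orP[lt|lt].
  exists i', j; split=> //; first exact: ltnW.
  by apply: (has_orderD at_Xoo_vring Hz ow); lia.
exists i, m; split=> //.
by rewrite addrC; apply: (has_orderD at_Xoo_vring ow Hz); lia.
Qed.

Theorem pole_order_generated z n : regular_affine phi q x y z -> at_Yoo z ->
  ordX z (- n%:Z) -> base_semigroup q n.
Proof.
move=> rz Yz oz; have [p Ep] := regular_affineP splitK q0 fxy rz.
have [|P [Ez P0]] := regular_Yoo_normal_form _ Yz.
  by rewrite Ep; exact: normal_form_ev2.
have [z0|[i [j [ltjq ij oz']]]] := pole_order_Xoo (leqnn _) P0.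
  by have := has_order_neq0 at_Xoo_vring oz; rewrite Ez z0 eqxx.
rewrite -Ez in oz'; have := has_order_uniq at_Xoo_vring oz oz' => /oppr_inj[->].
exact: base_semigroup_pole.
Qed.

Theorem generated_pole_order n : base_semigroup q n ->
  exists z, [/\ regular_affine phi q x y z, at_Yoo z & ordX z (- n%:Z)].
Proof.
move: n; apply: generated_semigroup_ind.
- exists 1; split; last exact: (has_order1 at_Xoo_vring).
    by rewrite -(rmorph1 (ev2 phi x y)); exact: regular_affine_ev2.
  exact: (vring1 at_Yoo_vring).
- move=> m n [z [rz Yz oz]] [w [rw Yw ow]]; exists (z * w); split.
  + exact: regular_affineM.
  + exact: (vringM at_Yoo_vring).
  + rewrite PoszD opprD; exact: (has_orderM at_Xoo_vring).
move=> n /mapP[[|j]]; rewrite mem_iota // => lejq ->; exists (x * y ^+ j).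
split; last exact: order_xyn_Xoo.
  have -> : x * y ^+ j = ev2 phi x y ('X * 'X%:P ^+ j).
    by rewrite rmorphM rmorphXn /= !evE.
  exact: regular_affine_ev2.
by apply: regular_xyn_Yoo; lia.
Qed.

End PoleOrders.

(** * From homogeneous forms to affine charts *)

Lemma value_ev2 (K : fieldType) (a b : K) g : value a b g = ev2 idfun a b g.
Proof.
elim/poly_ind: g => [|g c IHg]; first by rewrite !rmorph0.
rewrite !rmorphD !rmorphM /= IHg valueX ev2X valueC ev2C ev1E.
by congr (_ + _.[_]); apply/polyP => i; rewrite coef_map.
Qed.

Section Charts.

Variables (K : fieldType) (i j k : 'I_3).
Hypotheses (ij : i != j) (ik : i != k) (jk : j != k).

Let cover l : [|| l == i, l == j | l == k].
Proof. by move: l i j k ij ik jk; do 4!case=> [[|[|[|//]]] ?]. Qed.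

(** One polynomial [p] has to serve both for the functions on the curve and for
    the values at a point, hence the quantification over [L] and [phi]. *)
Lemma dehomogenize d (A : {mpoly K[3]}) : A \is d.-homog ->
  exists p, forall (L : fieldType) (phi : {rmorphism K -> L}) v, v k != 0 ->
  mmap phi v A = v k ^+ d * ev2 phi (v i / v k) (v j / v k) p.
Proof.
move=> /dhomogP hA.
pose h l : {poly {poly K}} :=
  if l == i then 'X else if l == j then 'X%:P else 1.
exists (\sum_(m <- msupp A) (A@_m)%:P%:P * \prod_l h l ^+ m l) => L phi v vk0.
rewrite rmorph_sum mulr_sumr [LHS]/mmap big_seq [RHS]big_seq.
apply: eq_bigr => m mA; rewrite rmorphM /= !evE mulrCA; congr (_ * _).
have Eh l : ev2 phi (v i / v k) (v j / v k) (h l) = v l / v k.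
  rewrite /h; case/or3P: (cover l) => /eqP->; first by rewrite eqxx !evE.
    by rewrite eq_sym (negPf ij) eqxx !evE.
  by rewrite ![k == _]eq_sym (negPf ik) (negPf jk) rmorph1 divff.
have Ed : mdeg m = d := hA m mA.
rewrite rmorph_prod /mmap1 -Ed mdegE -prodrXr -big_split /=.
by apply: eq_bigr => l _; rewrite rmorphXn /= Eh -exprMn mulrC divfK.
Qed.

(** All large degrees are allowed because a numerator and a denominator must be
    homogenized in the same degree. *)
Definition homogenizable (p : {poly {poly K}}) :=
  exists d0, forall d, (d0 <= d)%N ->
  exists A : {mpoly K[3]}, A \is d.-homog /\
  forall (L : fieldType) (phi : {rmorphism K -> L}) v, v k != 0 ->
  mmap phi v A = v k ^+ d * ev2 phi (v i / v k) (v j / v k) p.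

Lemma homogenizableD p r :
  homogenizable p -> homogenizable r -> homogenizable (p + r).
Proof.
move=> [d hp] [e hr]; exists (maxn d e) => n; rewrite geq_max.
move=> /andP[/hp[A [hA EA]] /hr[B [hB EB]]].
exists (A + B); split=> [|L phi v vk]; first exact: dhomogD.
by rewrite mmapD EA // EB // -mulrDr rmorphD.
Qed.

Lemma homogenizableM p g l :
  (forall (L : fieldType) (phi : {rmorphism K -> L}) v,
     ev2 phi (v i / v k) (v j / v k) g = v l / v k) ->
  homogenizable p -> homogenizable (p * g).
Proof.
move=> Eg [d hp]; exists d.+1 => -[|n] // /hp[A [hA EA]].
exists (A * 'X_l); split=> [|L phi v vk].
  have hX : ('X_l : {mpoly K[3]}) \is 1.-homog.
    by rewrite dhomogX; apply/eqP; exact: mdeg1.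
  by have := dhomogM hA hX; rewrite addn1.
rewrite rmorphM /= mmapX mmap1U EA // rmorphM /= Eg exprSr -!mulrA.
by congr (_ * _); rewrite mulrCA; congr (_ * _); rewrite mulrC divfK.
Qed.

Lemma homogenize p : homogenizable p.
Proof.
have hC c : homogenizable c%:P.
  elim/poly_ind: c => [|c a IHc].
    exists 0%N => d _; exists 0; split=> [|L phi v vk]; first exact: dhomog0.
    by rewrite mmap0 !rmorph0 mulr0.
  rewrite polyCD polyCM; apply: homogenizableD.
    by apply: (homogenizableM (l := j)) => // L phi v; rewrite !evE.
  exists 0%N => d _; exists (a *: 'X_k ^+ d); split=> [|L phi v vk].
    have hX : ('X_k : {mpoly K[3]}) \is 1.-homog.
      by rewrite dhomogX; apply/eqP; exact: mdeg1.
    by apply: dhomogZ; have := dhomogMn d hX; rewrite mul1n.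
  by rewrite mmapZ rmorphXn /= mmapX mmap1U !evE mulrC.
elim/poly_ind: p => [|p c IHp]; first by rewrite -polyC0.
apply: homogenizableD => //.
by apply: (homogenizableM (l := i)) => // L phi v; rewrite !evE.
Qed.

Variables (L : fieldType) (phi : {rmorphism K -> L}) (v : 'I_3 -> L).
Hypothesis vk0 : v k != 0.

Lemma local_ring_chart (Q : 'I_3 -> K) z : Q k != 0 ->
  (exists d (A B : {mpoly K[3]}),
    [/\ A \is d.-homog, B \is d.-homog, B.@[Q] != 0
      & z = mmap phi v A / mmap phi v B]) <->
  local_ring phi (v i / v k) (v j / v k) (Q i / Q k) (Q j / Q k) z.
Proof.
move=> Qk0; split=> [[d [A [B [hA hB BQ ->]]]]|[p [r [r0 ->]]]].
  have [p Ep] := dehomogenize hA; have [r Er] := dehomogenize hB.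
  exists p, r; rewrite Ep // Er // invfM mulrACA divff ?expf_neq0 // mul1r.
  split=> //; move: BQ; rewrite /meval (Er K idfun) // mulf_eq0 negb_or.
  by rewrite -value_ev2; case/andP.
have [d hp] := homogenize p; have [e hr] := homogenize r.
have [A [hA EA]] := hp (maxn d e) (leq_maxl _ _).
have [B [hB EB]] := hr (maxn d e) (leq_maxr _ _).
exists (maxn d e), A, B; split=> //.
  by rewrite /meval (EB K idfun) // mulf_neq0 ?expf_neq0 // -value_ev2.
by rewrite EA // EB // invfM mulrACA divff ?expf_neq0 // mul1r.
Qed.

End Charts.

(** * The base points *)

Lemma divf_cancelr (E : fieldType) (a b c : E) :
  c != 0 -> (b / c) / (a / c) = b / a.
Proof. by move=> c0; rewrite invf_div mulrA divfK. Qed.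

Section BasePoints.

Variables (F : finFieldType) (K : fieldType).
Hypothesis splitK : split_field K.

Local Notation q := #|F|.
Local Notation L := (funfield F K).

Let q0 : (0 < q)%N. Proof. by rewrite ltnW // finNzRing_gt1. Qed.

Let phi : {rmorphism K -> L} := @fun_const F K.
Let v : 'I_3 -> L := tnth [tuple fun_x F K; fun_y F K; 1].

Lemma ev1_fun_y p : ev1 phi (fun_y F K) p = (@FracField.tofrac {poly K} p)%:A.
Proof.
elim/poly_ind: p => [|p c IHp]; first by rewrite rmorph0 tofrac0 scale0r.
rewrite rmorphD rmorphM /= IHp ev1X ev1C tofracD tofracM scalerDl.
by rewrite -scalerAl mul1r scalerA.
Qed.

Lemma fun_y_transcendental : transcendental phi (fun_y F K).
Proof.
move=> p; rewrite ev1_fun_y => /eqP; rewrite scaler_eq0 oner_eq0 orbF.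
by rewrite tofrac_eq0 => /eqP.
Qed.

(** If x or x/y were a constant, the curve equation would be a polynomial
    relation for the transcendental y, nontrivial since the coefficient of y is
    1. *)
Lemma fun_xy_nonconstant : nonconstant_pair phi q (fun_x F K) (fun_y F K).
Proof.
have rel := fun_xyP F K; have ty := fun_y_transcendental.
have aux (r : {poly K}) : r`_1 = 0 -> ev1 phi (fun_y F K) (r + 'X) <> 0.
  move=> r1 /ty/(congr1 (fun p : {poly K} => p`_1)).
  by rewrite coefD r1 coefX coef0 add0r => /eqP; rewrite oner_eq0.
split=> // c.
- apply/negP => /eqP Ex.
  apply: (aux (c *: 'X^(q.+1) + (c ^+ q.+1)%:P)).
    rewrite coefD coefZ coefXn coefC eqSS eq_sym (negPf (lt0n_neq0 q0)).
    by rewrite mulr0 addr0.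
  rewrite rmorphD /= rmorphD /= -mul_polyC rmorphM /= rmorphXn /= !evE.
  by rewrite rmorphXn /= -Ex.
- apply/negP => /eqP Ey; have /ty/eqP : ev1 phi (fun_y F K) ('X - c%:P) = 0.
    by rewrite rmorphB /= !evE Ey subrr.
  by rewrite polyXsubC_eq0.
apply/negP => /eqP Ex.
apply: (aux (c *: 'X^(q.+2) + c ^+ q.+1 *: 'X^(q.+1))).
  rewrite coefD !coefZ !coefXn !eqSS ![0%N == _]eq_sym.
  by rewrite (negPf (lt0n_neq0 q0)) !mulr0 addr0.
rewrite rmorphD /= rmorphD /= -!mul_polyC !rmorphM /= !rmorphXn /= !evE.
by rewrite mulrA -exprMn -Ex.
Qed.

Lemma on_curveE (Q : 'rV[K]_3) : on_curve F Q = (Q != 0) &&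
  (Q 0 0 * Q 0 1 ^+ q.+1 + Q 0 0 ^+ q.+1 * Q 0 2%R + Q 0 1 * Q 0 2%R ^+ q.+1
     == 0).
Proof.
have EX (l : 'I_3) n : ('X_l ^+ n : {mpoly K[3]}).@[Q 0] = Q 0 l ^+ n.
  by rewrite (rmorphXn (meval (Q 0))) /= mevalXU.
by rewrite /on_curve /pellikaan_form !mevalD !mevalM !EX !mevalXU.
Qed.

(** [a], [b], [c] will be a cyclic permutation of the homogeneous coordinates,
    which makes the vertex [P] of the fundamental triangle play the role of
    X_oo, and the next vertex the role of Y_oo. *)
Variables a b c : 'I_3.
Hypotheses (ab : a != b) (ac : a != c) (bc : b != c).
Hypothesis Mabc : nonconstant_pair phi q (v a / v c) (v b / v c).
Hypothesis curve_abc : forall Q, on_curve F (K := K) Q = (Q != 0) &&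
  (Q 0 a * Q 0 b ^+ q.+1 + Q 0 a ^+ q.+1 * Q 0 c + Q 0 b * Q 0 c ^+ q.+1 == 0).

Let v_neq0 l : v l != 0.
Proof.
have [_ /(_ 0) + /(_ 0) + _] := fun_xy_nonconstant; rewrite rmorph0 => x0 y0.
by case: l => [[|[|[|//]]] ?]; rewrite /v (tnth_nth 0) //= oner_neq0.
Qed.

Let P : 'rV[K]_3 := delta_mx 0 a.
Let x := v a / v c.
Let y := v b / v c.

Let cover l : [|| l == a, l == b | l == c].
Proof. by move: l a b c ab ac bc; do 4!case=> [[|[|[|//]]] ?]. Qed.

Lemma row_eq0 (Q : 'rV[K]_3) :
  (Q == 0) = [&& Q 0 a == 0, Q 0 b == 0 & Q 0 c == 0].
Proof.
apply/eqP/and3P => [->|[/eqP Qa /eqP Qb /eqP Qc]]; first by rewrite !mxE.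
by apply/rowP => l; rewrite mxE; case/or3P: (cover l) => /eqP->.
Qed.

Lemma eq_base_point (Q : 'rV[K]_3) : Q != 0 ->
  (Q == P)%MS = (Q 0 b == 0) && (Q 0 c == 0).
Proof.
move=> Q0; apply/andP/andP => [[/sub_rVP[l ->] _]|[/eqP Qb /eqP Qc]].
  by rewrite !mxE ![_ == a]eq_sym (negPf ab) (negPf ac) !mulr0.
have Qa : Q 0 a != 0 by move: Q0; rewrite row_eq0 Qb Qc eqxx !andbT.
have EQ : Q = Q 0 a *: P.
  apply/rowP => l; rewrite !mxE /=; case/or3P: (cover l) => /eqP->.
  - by rewrite !eqxx mulr1.
  - by rewrite Qb eq_sym (negPf ab) mulr0.
  - by rewrite Qc eq_sym (negPf ac) mulr0.
split; apply/sub_rVP; first by exists (Q 0 a).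
by exists (Q 0 a)^-1; rewrite {2}EQ scalerA mulVf // scale1r.
Qed.

Lemma regular_at_affine (Q : 'rV[K]_3) z : Q 0 c != 0 ->
  regular_at Q z <-> local_ring phi x y (Q 0 a / Q 0 c) (Q 0 b / Q 0 c) z.
Proof.
exact: (@local_ring_chart K a b c ab ac bc L phi v (v_neq0 c) (Q 0)).
Qed.

Lemma regular_at_Xoo (Q : 'rV[K]_3) z : Q 0 a != 0 -> Q 0 b = 0 -> Q 0 c = 0 ->
  regular_at Q z <-> at_Xoo phi x y z.
Proof.
move=> Qa Qb Qc; rewrite /at_Xoo.
have -> : y / x = v b / v a by apply: divf_cancelr.
rewrite /x invf_div -(mul0r (Q 0 a)^-1) -{1}Qb -Qc.
have ba : b != a by rewrite eq_sym.
have ca : c != a by rewrite eq_sym.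
exact: (@local_ring_chart K b c a bc ba ca L phi v (v_neq0 a) (Q 0)).
Qed.

Lemma regular_at_Yoo (Q : 'rV[K]_3) z : Q 0 b != 0 -> Q 0 c = 0 -> Q 0 a = 0 ->
  regular_at Q z <-> at_Yoo phi x y z.
Proof.
move=> Qb Qc Qa; rewrite /at_Yoo.
have -> : x / y = v a / v b by apply: divf_cancelr.
rewrite /y invf_div -(mul0r (Q 0 b)^-1) -{1}Qc -Qa.
have ca : c != a by rewrite eq_sym.
have cb : c != b by rewrite eq_sym.
exact: (@local_ring_chart K c a b ca cb ab L phi v (v_neq0 b) (Q 0)).
Qed.

Lemma value_curve_poly (r s : K) :
  value r s (curve_poly K q) = r * s ^+ q.+1 + r ^+ q.+1 + s.
Proof.
rewrite /curve_poly !rmorphD /= -mul_polyC rmorphM !rmorphXn /= valueX !valueC.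
by rewrite hornerX mulrC [X in X + _]addrC.
Qed.

Theorem base_point_semigroup n :
  weierstrass_semigroup F P n <-> base_semigroup q n.
Proof.
have P0 : P != 0 by rewrite row_eq0 /P !mxE !eqxx /= oner_eq0.
split=> [[z poles]|Hn]; last first.
  have [z [rz Yz oz]] := generated_pole_order splitK q0 Mabc Hn.
  exists z => Q; rewrite curve_abc => /andP[Q0 fQ]; rewrite eq_base_point //.
  have [/andP[/eqP Qb /eqP Qc]|nP] := boolP (_ && _).
    have Qa : Q 0 a != 0 by move: Q0; rewrite row_eq0 Qb Qc eqxx !andbT.
    have D := at_Xoo_vring splitK q0 Mabc.
    rewrite /pole_order_at; case: eqP => [n0|_].
      apply/regular_at_Xoo => //; apply: (has_order_regular D oz).
      by rewrite n0.
    apply: (ord_ext (R := at_Xoo phi x y)); last exact: (has_order_ord D oz).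
    by move=> w; apply: iff_sym; exact: regular_at_Xoo.
  rewrite /pole_order_at eqxx.
  have [Qc|Qc] := eqVneq (Q 0 c) 0.
    rewrite Qc eqxx andbT in nP.
    apply/regular_at_Yoo => //; apply/eqP.
    move: fQ; rewrite Qc !expr0n !mulr0 !addr0 mulf_eq0 expf_eq0 /= (negPf nP).
    by rewrite orbF.
  apply/regular_at_affine => //; apply: rz; rewrite value_curve_poly.
  apply: (mulIf (expf_neq0 q.+2 Qc)); rewrite mul0r -(eqP fQ) !expr_div_n.
  by rewrite !exprS; field; rewrite expf_neq0 ?Qc.
have Pa : P 0 a = 1 by rewrite mxE !eqxx.
have Pb : P 0 b = 0 by rewrite mxE eqxx eq_sym (negPf ab).
have Pc : P 0 c = 0 by rewrite mxE eqxx eq_sym (negPf ac).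
have oP : on_curve F P.
  by rewrite curve_abc P0 Pa Pb Pc !expr0n /= !(mulr0, mul0r, addr0).
case: (posnP n) => [->|n0]; first exact: generated_semigroup0.
have regular_off_P Q : on_curve F Q ->
    ~~ ((Q 0 b == 0) && (Q 0 c == 0)) -> regular_at Q z.
  move=> oQ nP; have /andP[Q0 _] := oQ; have := poles Q oQ.
  by rewrite eq_base_point // (negPf nP).
have D := at_Xoo_vring splitK q0 Mabc.
apply: (pole_order_generated splitK q0 Mabc (z := z)).
- move=> r s; rewrite value_curve_poly => rs0.
  pose Q : 'rV[K]_3 := \row_l (if l == a then r else if l == b then s else 1).
  have Qa : Q 0 a = r by rewrite mxE eqxx.
  have Qb : Q 0 b = s by rewrite mxE eq_sym (negPf ab) eqxx.
  have Qc : Q 0 c = 1 by rewrite mxE ![c == _]eq_sym (negPf ac) (negPf bc).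
  have Qc0 : Q 0 c != 0 by rewrite Qc oner_neq0.
  have /(regular_at_affine _ Qc0) : regular_at Q z; last first.
    by rewrite Qa Qb Qc !divr1.
  apply: regular_off_P; last by rewrite (negPf Qc0) andbF.
  rewrite curve_abc row_eq0 (negPf Qc0) !andbF /=.
  by rewrite Qa Qb Qc !expr1n !mulr1 rs0.
- pose Q : 'rV[K]_3 := delta_mx 0 b.
  have Qa : Q 0 a = 0 by rewrite mxE (negPf ab) andbF.
  have Qb : Q 0 b = 1 by rewrite mxE !eqxx.
  have Qc : Q 0 c = 0 by rewrite mxE eqxx [c == _]eq_sym (negPf bc).
  apply/(regular_at_Yoo (Q := Q)) => //; first by rewrite Qb oner_neq0.
  apply: regular_off_P; last by rewrite Qb oner_eq0.
  have Q0 : Q != 0 by rewrite row_eq0 Qb oner_eq0 andbF.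
  by rewrite curve_abc Q0 Qa Qb Qc !expr0n /= !(mulr0, mul0r, addr0).
have := poles P oP; rewrite eq_base_point // Pb Pc eqxx /pole_order_at.
rewrite (negPf (lt0n_neq0 n0)) => oz.
apply: (ord_has_order D); apply: ord_ext oz => w.
by apply: regular_at_Xoo => //; rewrite Pa oner_neq0.
Qed.

End BasePoints.

Unset Implicit Arguments.

Theorem theorem3p1 (F : finFieldType) (K : closedFieldType)
    (inc : {rmorphism F -> K}) (algK : forall a : K, algebraicOver inc a)
    (P : 'rV[K]_3) (baseP : P \in [:: pt_O K; pt_Xoo K; pt_Yoo K]) (n : nat) :
  weierstrass_semigroup F P n <->
  generated_semigroup [seq (k * #|F| + 1)%N | k <- iota 1 #|F|.+1] n.
Proof.
have splitK : split_field K.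
  by move=> p; have [rs Ep] := closed_field_poly_normal p; exists rs.
have M0 := fun_xy_nonconstant F K.
move: baseP; rewrite !inE => /or3P[]/eqP->.
- apply: (@base_point_semigroup F K splitK 2%R 0 1) => //.
    rewrite !(tnth_nth 0) /= div1r; exact: nonconstant_pair_cycle2.
  by move=> Q; rewrite on_curveE; congr (_ && (_ == 0)); ring.
- apply: (@base_point_semigroup F K splitK 0 1 2%R) => //.
    by rewrite !(tnth_nth 0) /= !divr1.
  exact: on_curveE.
apply: (@base_point_semigroup F K splitK 1 2%R 0) => //.
  rewrite !(tnth_nth 0) /= div1r; exact: nonconstant_pair_cycle.
by move=> Q; rewrite on_curveE; congr (_ && (_ == 0)); ring.
Qed.
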